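(* Let $K\subset[0,\infty)$ be an infinite countable closed set containing $0$, with the Euclidean metric and base point $0$, and let $\mathcal G(K)$ be its family of gaps. For $I=(a_I,b_I)\in\mathcal G(K)$ put $$\mu_I=\frac{\delta(b_I)-\delta(a_I)}{b_I-a_I}\in\mathcal F(K).$$ Then the map $$U:\ell^1(\mathcal G(K))\to\mathcal F(K),\qquad U((c_I))=\sum_{I\in\mathcal G(K)}c_I\mu_I,$$ is an isometric isomorphism onto $\mathcal F(K)$. Consequently, $$\|f\|_{\operatorname{Lip}}=\sup_{I\in\mathcal G(K)}|\Delta_I f|\qquad (f\in\operatorname{Lip}_0(K)).$$
   Context: All Banach spaces are real. For a pointed metric space $(M,d,0)$, $\operatorname{Lip}_0(M)$ is the Banach space of Lipschitz $f:M\to\mathbb R$ with $f(0)=0$, with norm $\|f\|_{\operatorname{Lip}}=\sup_{x\ne y}|f(x)-f(y)|/d(x,y)$, and $\mathcal F(M)=\overline{\operatorname{span}}\{\delta(x):x\in M\}\subset\operatorname{Lip}_0(M)^*$, where $\langle f,\delta(x)\rangle=f(x)$, is the Lipschitz-free space. For $K$ as in the claim let $R_K=\sup K\in(0,\infty]$, and $I_K=[0,R_K]$ if $R_K<\infty$, $I_K=[0,\infty)$ if $R_K=\infty$. $\mathcal G(K)$ is the family of bounded connected components of $I_K\setminus K$ (the gaps); each $I\in\mathcal G(K)$ is an open interval $I=(a_I,b_I)$ with $a_I<b_I$, $a_I,b_I\in K$. For $f\in\operatorname{Lip}_0(K)$ the gap slopes are $\Delta_I f=\dfrac{f(b_I)-f(a_I)}{b_I-a_I}$.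 *)

(* Defs.v *)
From HB Require Import structures.
From mathcomp Require Import all_boot all_order all_algebra finmap.
From mathcomp Require Import all_classical all_reals all_analysis.
From mathcomp Require Import lra.

Set Implicit Arguments.
Unset Strict Implicit.
Unset Printing Implicit Defensive.

Import Order.TTheory GRing.Theory Num.Theory.
Import numFieldNormedType.Exports.

Local Open Scope classical_set_scope.
Local Open Scope ring_scope.

Section Aux.
Context {R : realType}.

Lemma sup_le_nneg (S : set R) (C : R) : 0 <= C -> ubound S C -> sup S <= C.
Proof.
move=> C0 SC; have [->|/set0P S0] := eqVneq S set0; first by rewrite sup0.
exact: ge_sup.
Qed.

Lemma sup_nneg (S : set R) : has_ubound S -> (forall x, S x -> 0 <= x) ->
  0 <= sup S.
Proof.
move=> ubS S0; have [->|/set0P[x Sx]] := eqVneq S set0; first by rewrite sup0.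
exact: le_trans (S0 _ Sx) (ub_le_sup ubS Sx).
Qed.

Lemma homogeneous_le (V : lmodType R) (N : V -> R) : (forall x, 0 <= N x) ->
  (forall l x, N (l *: x) <= `|l| * N x) ->
  forall l x, N (l *: x) = `|l| * N x.
Proof.
move=> N0 NZ l x; apply/eqP; rewrite eq_le NZ/=.
have [->|l0] := eqVneq l 0; first by rewrite normr0 mul0r.
rewrite -ler_pdivlMl ?normr_gt0// -normfV.
by rewrite -{1}[x](scalerK l0) NZ.
Qed.

End Aux.

Section Lip0.
Context {R : realType} {M : metricType R} (o : M).

Definition lip0_pred : {pred M -> R} := fun f => `[< f o = 0 /\
  exists L : R, forall x y, `|f x - f y| <= L * mdist x y >].

Record lip0 := Lip0 { lip0_fun :> M -> R ; _ : lip0_fun \in lip0_pred }.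

HB.instance Definition _ := [isSub for lip0_fun].
HB.instance Definition _ := [Choice of lip0 by <:].

Fact lip0_submod_closed : submod_closed lip0_pred.
Proof.
split=> [|a f g].
  apply/asboolP; split=> //; exists 0 => x y.
  by rewrite /= subrr normr0 mul0r.
move=> /asboolP[f0 [L fL]] /asboolP[g0 [L' gL]].
apply/asboolP; split; first by rewrite !fctE/= f0 g0 scaler0 addr0.
exists (`|a| * L + L') => x y; rewrite !fctE/=.
rewrite opprD addrACA -scalerBr (le_trans (ler_normD _ _))// mulrDl lerD//.
by rewrite normrZ -mulrA ler_wpM2l.
Qed.

HB.instance Definition _ :=
  GRing.isSubmodClosed.Build R (M -> R) lip0_pred lip0_submod_closed.
HB.instance Definition _ := [SubChoice_isSubLmodule of lip0 by <:].

Lemma lip0DE (f g : lip0) x : (f + g) x = f x + g x. Proof. by []. Qed.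

Lemma lip0ZE (l : R) (f : lip0) x : (l *: f) x = l * f x. Proof. by []. Qed.

Definition lip_quotients (f : M -> R) : set R :=
  [set r | exists x y, x != y /\ r = `|f x - f y| / mdist x y].

Definition lip_norm (f : lip0) : R := sup (lip_quotients f).

Lemma lip0_base (f : lip0) : f o = 0.
Proof. by case: f => f /= /asboolP[]. Qed.

Lemma lip_quotients_ub (f : lip0) : has_ubound (lip_quotients f).
Proof.
case: f => f /= /asboolP[_ [L fL]]; exists L => _ [x [y [xy ->]]].
by rewrite ler_pdivrMr ?mdist_gt0.
Qed.

Lemma lip_norm_ge0 (f : lip0) : 0 <= lip_norm f.
Proof.
apply: sup_nneg (lip_quotients_ub f) _ => _ [x [y [_ ->]]].
by rewrite divr_ge0// mdist_ge0.
Qed.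

Lemma lip_normP (f : lip0) x y : `|f x - f y| <= lip_norm f * mdist x y.
Proof.
have [->|xy] := eqVneq x y; first by rewrite subrr normr0 mdistxx mulr0.
rewrite -ler_pdivrMr ?mdist_gt0//; apply: ub_le_sup.
  exact: lip_quotients_ub.
by exists x, y.
Qed.

Lemma lip_norm_le (f : lip0) C : 0 <= C ->
  (forall x y, `|f x - f y| <= C * mdist x y) -> lip_norm f <= C.
Proof.
move=> C0 fC; apply: sup_le_nneg => // _ [x [y [xy ->]]].
by rewrite ler_pdivrMr ?mdist_gt0.
Qed.

Fact lip_normD (f g : lip0) : lip_norm (f + g) <= lip_norm f + lip_norm g.
Proof.
apply: lip_norm_le => [|x y]; first by rewrite addr_ge0 ?lip_norm_ge0.
rewrite !lip0DE opprD addrACA (le_trans (ler_normD _ _))// mulrDl.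
by rewrite lerD// lip_normP.
Qed.

Fact lip_normZ (l : R) (f : lip0) : lip_norm (l *: f) = `|l| * lip_norm f.
Proof.
apply: homogeneous_le => {l f} [|l f]; first exact: lip_norm_ge0.
apply: lip_norm_le => [|x y]; first by rewrite mulr_ge0 ?lip_norm_ge0.
by rewrite !lip0ZE -mulrBr normrM -mulrA ler_wpM2l// lip_normP.
Qed.

Fact lip_norm0_eq0 (f : lip0) : lip_norm f = 0 -> f = 0.
Proof.
move=> f0; apply/val_inj/funext => x /=.
have := lip_normP f x o.
by rewrite f0 mul0r normr_le0 lip0_base subr0 => /eqP.
Qed.

HB.instance Definition _ :=
  Lmodule_isNormed.Build R lip0 lip_normD lip_normZ lip_norm0_eq0.

Lemma lip0_normE (f : lip0) : `|f| = lip_norm f. Proof. by []. Qed.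

End Lip0.

Section Dual.
Context {R : realType} (V : normedModType R).

Definition dual_pred : {pred V -> R} :=
  fun phi => `[< linear phi /\ continuous phi >].

Record topdual := TopDual { dual_fun :> V -> R ; _ : dual_fun \in dual_pred }.

HB.instance Definition _ := [isSub for dual_fun].
HB.instance Definition _ := [Choice of topdual by <:].

Fact dual_submod_closed : submod_closed dual_pred.
Proof.
split=> [|a f g].
  apply/asboolP; split; last by move=> x; exact: cst_continuous.
  by move=> l x y; rewrite /= scaler0 addr0.
move=> /asboolP[fl fc] /asboolP[gl gc].
apply/asboolP; split.
  move=> l x y; rewrite !fctE/= fl gl !scalerDr !scalerA (mulrC a) -!addrA.
  by congr (_ + _); rewrite addrCA.
by move=> x; apply: cvgD; [apply: cvgZr; exact: fc|exact: gc].
Qed.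

HB.instance Definition _ :=
  GRing.isSubmodClosed.Build R (V -> R) dual_pred dual_submod_closed.
HB.instance Definition _ := [SubChoice_isSubLmodule of topdual by <:].

Lemma dualDE (f g : topdual) x : (f + g) x = f x + g x. Proof. by []. Qed.

Lemma dualZE (l : R) (f : topdual) x : (l *: f) x = l * f x. Proof. by []. Qed.

Definition dual_norm (phi : topdual) : R :=
  sup [set `|phi x| | x in [set x : V | `|x| <= 1]].

Lemma dual_linear (phi : topdual) : linear phi.
Proof. by case: phi => phi /= /asboolP[]. Qed.

HB.instance Definition _ (phi : topdual) :=
  GRing.isLinear.Build R V R *:%R phi (dual_linear phi).

Lemma dual_continuous (phi : topdual) : continuous phi.
Proof. by case: phi => phi /= /asboolP[]. Qed.

Lemma dual_bounded (phi : topdual) :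
  exists2 C, 0 < C & forall x, `|phi x| <= C * `|x|.
Proof.
have /linear_boundedP := continuous_linear_bounded 0 (@dual_continuous phi 0).
move=> /pinfty_ex_gt0[C C0 phiC]; exists C => //.
Qed.

Lemma dual_norm_ub (phi : topdual) :
  has_ubound [set `|phi x| | x in [set x : V | `|x| <= 1]].
Proof.
have [C C0 phiC] := dual_bounded phi; exists C => _ [x /= x1 <-].
by rewrite (le_trans (phiC x))// ler_piMr// ltW.
Qed.

Lemma dual_norm_ge0 (phi : topdual) : 0 <= dual_norm phi.
Proof. by apply: sup_nneg (dual_norm_ub phi) _ => _ [x _ <-]. Qed.

Lemma dual_normP (phi : topdual) x : `|phi x| <= dual_norm phi * `|x|.
Proof.
have [->|x0] := eqVneq x 0; first by rewrite linear0 !normr0 mulr0.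
rewrite -ler_pdivrMr ?normr_gt0//.
have -> : `|phi x| / `|x| = `|phi (`|x|^-1 *: x)|.
  by rewrite linearZ normrZ normfV normr_id mulrC.
apply: ub_le_sup; first exact: dual_norm_ub.
exists (`|x|^-1 *: x) => //=.
by rewrite normrZ normfV normr_id mulVf// normr_eq0.
Qed.

Lemma dual_norm_le (phi : topdual) C : 0 <= C ->
  (forall x, `|phi x| <= C * `|x|) -> dual_norm phi <= C.
Proof.
move=> C0 phiC; apply: sup_le_nneg => // _ [x /= x1 <-].
by rewrite (le_trans (phiC x))// ler_piMr.
Qed.

Fact dual_normD (f g : topdual) : dual_norm (f + g) <= dual_norm f + dual_norm g.
Proof.
apply: dual_norm_le => [|x]; first by rewrite addr_ge0 ?dual_norm_ge0.
by rewrite dualDE (le_trans (ler_normD _ _))// mulrDl lerD// dual_normP.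
Qed.

Fact dual_normZ (l : R) (f : topdual) : dual_norm (l *: f) = `|l| * dual_norm f.
Proof.
apply: homogeneous_le => {l f} [|l f]; first exact: dual_norm_ge0.
apply: dual_norm_le => [|x]; first by rewrite mulr_ge0 ?dual_norm_ge0.
by rewrite dualZE normrM -mulrA ler_wpM2l// dual_normP.
Qed.

Fact dual_norm0_eq0 (f : topdual) : dual_norm f = 0 -> f = 0.
Proof.
move=> f0; apply/val_inj/funext => x /=.
by have := dual_normP f x; rewrite f0 mul0r normr_le0 => /eqP.
Qed.

HB.instance Definition _ :=
  Lmodule_isNormed.Build R topdual dual_normD dual_normZ dual_norm0_eq0.

Lemma topdual_normE (phi : topdual) : `|phi| = dual_norm phi. Proof. by []. Qed.

End Dual.

Definition lspan {R : realType} {V : lmodType R} (A : set V) : set V :=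
  [set v | exists (n : nat) (a : 'I_n -> R) (x : 'I_n -> V),
    (forall i, A (x i)) /\ v = \sum_(i < n) a i *: x i].

Section LipFree.
Context {R : realType} {M : metricType R} (o : M).

Fact delta_dual (x : M) : (fun f : lip0 o => f x) \in @dual_pred R (lip0 o).
Proof.
apply/asboolP.
have lin : linear (fun f : lip0 o => f x) by [].
split=> //.
pose L := GRing.isLinear.Build R (lip0 o) R *:%R _ lin.
pose ev : {linear lip0 o -> R} := HB.pack (fun f : lip0 o => f x) L.
apply: (@bounded_linear_continuous _ _ _ ev).
apply/linear_boundedP; near=> C => f /=.
rewrite -[f x]subr0 -[0](lip0_base f) (le_trans (lip_normP f x o))//.
by rewrite mulrC ler_wpM2r ?lip_norm_ge0.
Unshelve. all: by end_near. Qed.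

Definition delta (x : M) : topdual (lip0 o) := TopDual (delta_dual x).

Definition lipfree : set (topdual (lip0 o)) := closure (lspan (range delta)).

End LipFree.
Arguments lipfree {R M} o _.

Section Ell1.
Context {R : realType} (I : choiceType).

Definition ell1_pred : {pred I -> R} :=
  fun c => `[< summable [set: I] (EFin \o c) >].

Record ell1 := Ell1 { ell1_fun :> I -> R ; _ : ell1_fun \in ell1_pred }.

HB.instance Definition _ := [isSub for ell1_fun].
HB.instance Definition _ := [Choice of ell1 by <:].

Lemma esumZ_le (l : R) (c : I -> R) :
  (\esum_(i in [set: I]) `|(l *: c i)%:E| <=
   `|l|%:E * \esum_(i in [set: I]) `|(c i)%:E|)%E.
Proof.
apply: ge_ereal_sup => _ [A [fA _] <-].
under eq_fsbigr do rewrite /= normrM EFinM.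
rewrite -ge0_mule_fsumr; last by move=> i; rewrite lee_fin.
by rewrite lee_wpmul2l ?lee_fin//; apply: ereal_sup_ubound; exists A.
Qed.

Fact ell1_submod_closed : submod_closed ell1_pred.
Proof.
split=> [|a f g].
  apply/asboolP; rewrite /summable esum1 ?ltry// => i _.
  by rewrite /= normr0.
move=> /asboolP sf /asboolP sg; apply/asboolP.
rewrite (_ : EFin \o _ = (EFin \o (a *: f)) \+ (EFin \o g))//.
apply: summableD => //; apply: le_lt_trans (esumZ_le a f) _.
by rewrite lte_mul_pinfty ?lee_fin.
Qed.

HB.instance Definition _ :=
  GRing.isSubmodClosed.Build R (I -> R) ell1_pred ell1_submod_closed.
HB.instance Definition _ := [SubChoice_isSubLmodule of ell1 by <:].

Lemma ell1DE (f g : ell1) x : (f + g) x = f x + g x. Proof. by []. Qed.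

Lemma ell1ZE (l : R) (f : ell1) x : (l *: f) x = l * f x. Proof. by []. Qed.

Definition ell1_norm (c : ell1) : R :=
  fine (\esum_(i in [set: I]) `|(c i)%:E|)%E.

Lemma ell1_summable (c : ell1) : summable [set: I] (EFin \o c).
Proof. by case: c => c /= /asboolP. Qed.

Lemma ell1_normE (c : ell1) :
  (ell1_norm c)%:E = (\esum_(i in [set: I]) `|(c i)%:E|)%E.
Proof. by rewrite fineK// -summableE; exact: ell1_summable. Qed.

Lemma ell1_norm_ge0 (c : ell1) : 0 <= ell1_norm c.
Proof. by rewrite -lee_fin ell1_normE esum_ge0. Qed.

Fact ell1_normD (f g : ell1) : ell1_norm (f + g) <= ell1_norm f + ell1_norm g.
Proof.
rewrite -lee_fin EFinD !ell1_normE -esumD// le_esum// => i _.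
by rewrite ell1DE -EFinD lee_fin ler_normD.
Qed.

Fact ell1_normZ (l : R) (f : ell1) : ell1_norm (l *: f) = `|l| * ell1_norm f.
Proof.
apply: homogeneous_le => {l f} [|l f]; first exact: ell1_norm_ge0.
by rewrite -lee_fin EFinM !ell1_normE esumZ_le.
Qed.

Fact ell1_norm0_eq0 (f : ell1) : ell1_norm f = 0 -> f = 0.
Proof.
move=> f0; apply/val_inj/funext => i /=.
apply/eqP; rewrite -normr_le0 -lee_fin -[0]f0 ell1_normE.
by apply: esum_ge; exists [set i]; rewrite ?fsbig_set1//; split.
Qed.

HB.instance Definition _ :=
  Lmodule_isNormed.Build R ell1 ell1_normD ell1_normZ ell1_norm0_eq0.

Lemma ell1_norm_def (c : ell1) : `|c| = ell1_norm c. Proof. by []. Qed.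

End Ell1.
Arguments ell1 R I : clear implicits.

Section FamilySum.
Context {I : choiceType}.

Definition fset_filter : set_system {fset I} :=
  filter_from [set: {fset I}] (fun A => [set B | (A `<=` B)%fset]).

#[global] Instance fset_filter_filter : ProperFilter fset_filter.
Proof.
apply: filter_from_proper => [|A _]; last by exists A; exact: fsubset_refl.
apply: filter_from_filter; first by exists fset0.
move=> A B _ _; exists (A `|` B)%fset => // C /=.
by rewrite fsubUset => /andP[].
Qed.

(* The limit along the net of finite partial sums, i.e. unconditional
   summation; like any [lim], it is meaningful only when the net converges. *)
Definition family_sum {R : realType} {V : normedModType R} (v : I -> V) : V :=
  lim ((fun B : {fset I} => \sum_(i <- B) v i) @ fset_filter).

End FamilySum.
Arguments fset_filter I : clear implicits.

Section SubspaceMetric.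
Context {R : realType} (K : set R).

Let sdist (x y : K) : R := `|val x - val y|.

Let sdist_ge0 x y : 0 <= sdist x y.
Proof. exact: normr_ge0. Qed.

Let sdist_positivity x y : sdist x y = 0 -> x = y.
Proof. by move=> /normr0_eq0/eqP; rewrite subr_eq0 => /eqP/val_inj. Qed.

Let ballEsdist x d : ball x d = [set y | sdist x y < d].
Proof. by []. Qed.

HB.instance Definition _ := PseudoMetric_isMetric.Build R (set_type K)
  sdist_ge0 sdist_positivity ballEsdist.

End SubspaceMetric.

Section Gaps.
Context {R : realType} (K : set R).

(* [0, sup K] if K is bounded above, and [0, +oo[ otherwise; the case
   [ereal_sup (EFin @` K) = -oo] means that K is empty. *)
Definition hull : set R :=
  if ereal_sup (EFin @` K) is r%:E then `[0, r]%classic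
  else `[0, +oo[%classic.

Definition gaps : set (set R) := [set I | bounded_set I /\
  exists2 x, (hull `\` K) x & I = connected_component (hull `\` K) x].

Context (hK : [/\ K `<=` `[0, +oo[, closed K & K 0]).

Definition base : K := exist _ 0 (let: And3 _ _ K0 := hK in mem_set K0).

Lemma hullP x : hull x <-> 0 <= x /\ (x%:E <= ereal_sup (EFin @` K))%E.
Proof.
have : (0%:E <= ereal_sup (EFin @` K))%E.
  by apply: ereal_sup_ubound; exists 0 => //; case: hK.
rewrite /hull; case: ereal_sup => [r||] //= r0.
  by rewrite in_itv/= lee_fin; split=> [/andP[]|[-> ->]].
by rewrite in_itv/= andbT leey; split=> [|[]].
Qed.

(* A gap is a set of reals; its endpoints a_I and b_I are recovered as its
   infimum and supremum. *)
Lemma gapP (I : gaps) : [/\ K (inf (val I)), K (sup (val I)),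
  inf (val I) < sup (val I) & val I = `]inf (val I), sup (val I)[%classic].
Proof.
case: I => I /= /set_mem [bI [x xHK IE]].
have [Kge0 clK K0] := hK.
have Ix : I x by rewrite IE; exact: connected_component_refl.
have IHK : I `<=` hull `\` K by rewrite IE; exact: connected_component_sub.
have Iitv : is_interval I.
  by apply/connected_intervalP; rewrite IE; exact: component_connected.
have Imax c d : c <= x <= d -> `[c, d] `<=` hull `\` K -> `[c, d] `<=` I.
  move=> cxd cdHK; rewrite IE; apply: connected_component_max => //.
    exact: segment_connected.
have [Inz Ilb Iub] : [/\ I !=set0, has_lbound I & has_ubound I].
  have [M [_ /(_ (M + 1))]] := bI.
  rewrite ltrDl ltr01 => /(_ isT) IM; split; first by exists x.
    by exists (- (M + 1)) => y /IM /=; rewrite ler_norml => /andP[].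
  by exists (M + 1) => y /IM /=; rewrite ler_norml => /andP[].
set a := inf I; set b := sup I.
have aI y : I y -> a <= y by move=> Iy; apply: ge_inf.
have bI' y : I y -> y <= b by move=> Iy; apply: ub_le_sup.
have ax t : a < t -> t <= x -> I t.
  move=> at_ tx; have [y Iy yt] := inf_lt Inz at_.
  by apply: (Iitv y x) => //; rewrite (ltW yt) tx.
have xb t : x <= t -> t < b -> I t.
  move=> xt tb; have [y Iy yt] := sup_gt Inz tb.
  by apply: (Iitv x y) => //; rewrite xt (ltW yt).
have x0 : 0 <= x by have [/hullP[]] := IHK _ Ix.
have xs : (x%:E <= ereal_sup (EFin @` K))%E by have [/hullP[]] := IHK _ Ix.
have nK z : ~ K z -> exists2 e : R, 0 < e & forall t, `|z - t| < e -> ~ K t.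
  move=> nKz; have := (@closed_openC _ K clK); rewrite openE => /(_ z nKz).
  by move=> /nbhs_ballP[e /= e0 ze]; exists e => // t zt; exact: ze.
have Ka : K a.
  apply: contrapT => nKa; have [e e0 ae] := nK _ nKa.
  have a0 : 0 <= a.
    by apply: lb_le_inf => // y /IHK[/hullP[]].
  have {}a0 : 0 < a.
    by rewrite lt_neqAle a0 andbT; apply: contra_notN nKa => /eqP <-.
  pose c := Num.max 0 (a - e / 2).
  have ca : c < a by rewrite gt_max a0/= ltrBlDr ltrDl divr_gt0.
  have : I c.
    apply: (Imax c x); last by rewrite /= in_itv/= lexx (le_trans (ltW ca)) ?aI.
      by rewrite lexx (le_trans (ltW ca)) ?aI.
    move=> t /=; rewrite in_itv/= => /andP[ct tx].
    have [/ax/(_ tx)/IHK//|ta] := ltP a t.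
    move: ct; rewrite ge_max => /andP[t0 ct]; split.
      by apply/hullP; rewrite t0 (le_trans _ xs)// lee_fin.
    apply: ae; rewrite ger0_norm ?subr_ge0//.
    by rewrite (@le_lt_trans _ _ (e / 2))// ?lerBlDr ?gtr_pMr ?invf_lt1 ?ltr1n// addrC -lerBlDr.
  by move=> /aI; rewrite leNgt ca.
have Kb : K b.
  apply: contrapT => nKb; have [e e0 be] := nK _ nKb.
  have bs : (b%:E <= ereal_sup (EFin @` K))%E.
    move: xs (fun y Iy => proj2 (proj1 (hullP y) (proj1 (IHK y Iy)))).
    case: ereal_sup => [r||]//= _ Ir; rewrite ?leey// lee_fin.
    by apply: ge_sup => // y /Ir.
  have : ((b - e)%:E < ereal_sup (EFin @` K))%E.
    by rewrite (lt_le_trans _ bs)// lte_fin ltrBlDr ltrDl.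
  move=> /ereal_sup_gt[_ [k Kk <-]]; rewrite lte_fin => bek.
  have bk : b + e <= k.
    rewrite leNgt; apply/negP => kbe; apply: (be k) => //.
    by rewrite ltr_distlC; apply/andP; split; lra.
  pose d := b + e / 2.
  have bd : b < d by rewrite /d; lra.
  have : I d.
    apply: (Imax x d); last by rewrite /= in_itv/= lexx andbT (le_trans (bI' _ Ix)) ?ltW.
      by rewrite lexx (le_trans (bI' _ Ix)) ?ltW.
    move=> t /=; rewrite in_itv/= => /andP[xt td].
    have [tb|bt] := ltP t b; first exact/IHK/xb.
    split.
      apply/hullP; split; first exact: le_trans xt.
      apply: le_ereal_sup_tmp; exists k%:E; first by exists k.
      by rewrite lee_fin; move: td; rewrite /d; lra.
    apply: be; rewrite ltr_distlC; move: td; rewrite /d => td.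
    by apply/andP; split; lra.
  by move=> /bI'; rewrite leNgt bd.
have Iab y : I y -> a < y < b.
  move=> Iy; have [_ nKy] := IHK _ Iy; rewrite !lt_neqAle aI// bI'// !andbT.
  by apply/andP; split; apply: contra_notN nKy => /eqP; [move=> <-|move=> ->].
split=> //.
  by have /andP[] := Iab _ Ix; exact: lt_trans.
apply/seteqP; split=> [y /Iab|y]; first by rewrite /= in_itv.
rewrite /= in_itv/= => /andP[ay yb].
by have [yx|xy] := leP y x; [exact: ax|exact: xb (ltW xy) yb].
Qed.

Definition gap_left (I : gaps) : K :=
  exist _ (inf (val I)) (let: And4 Ka _ _ _ := gapP I in mem_set Ka).

Definition gap_right (I : gaps) : K :=
  exist _ (sup (val I)) (let: And4 _ Kb _ _ := gapP I in mem_set Kb).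

Definition gap_molecule (I : gaps) : topdual (lip0 base) :=
  (val (gap_right I) - val (gap_left I))^-1 *:
    (delta base (gap_right I) - delta base (gap_left I)).

Definition gap_slope (I : gaps) (f : lip0 base) : R :=
  (f (gap_right I) - f (gap_left I)) / (val (gap_right I) - val (gap_left I)).

Definition gap_synthesis (c : ell1 R gaps) : topdual (lip0 base) :=
  family_sum (fun I => c I *: gap_molecule I).

End Gaps.

(* Main.v *)
(* Each gap I carries the 1-Lipschitz step function s_I equal to 0 on the left
   of I and to |I| on its right. Since the gaps are disjoint, sums of s_I with
   coefficients in [-1, 1] are 1-Lipschitz, so P phi = (phi s_I)_I maps the dual
   of Lip_0(K) to l^1 with norm at most 1; as Delta_J s_I = [I = J], P is a left
   inverse of U. With |U c| <= |c| this makes U an isometry. It remains to see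
   that U P fixes every delta(x), i.e. that for all f the Lipschitz function
   g(t) = (U P delta(t)) f - f(t) on K vanishes. It takes equal values at both
   ends of every gap because U P mu_I = mu_I; extended constantly across the
   gaps it is continuous on an interval with countably many values, hence
   constant. *)

Require Import Defs.
From HB Require Import structures.
From mathcomp Require Import all_boot all_order all_algebra finmap.
From mathcomp Require Import all_classical all_reals all_analysis.
From mathcomp Require Import lra.

Set Implicit Arguments.
Unset Strict Implicit.
Unset Printing Implicit Defensive.

Import Order.TTheory GRing.Theory Num.Theory.
Import numFieldNormedType.Exports.

Local Open Scope classical_set_scope.
Local Open Scope ring_scope.

(** * Closure properties of linear spans *)

Section Span.
Context {R : realType} {V : lmodType R} (A : set V).

Lemma lspan_linear (a : R) u v : lspan A u -> lspan A v -> lspan A (a *: u + v).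
Proof.
move=> [n [b [x [xA ->]]]] [m [c [y [yA ->]]]].
exists (n + m)%N,
  (fun i => match fintype.split i with inl j => a * b j | inr k => c k end),
  (fun i => match fintype.split i with inl j => x j | inr k => y k end); split.
  by move=> i; case: fintype.split.
rewrite big_split_ord scaler_sumr; congr (_ + _); apply: eq_bigr => i _.
  by rewrite (unsplitK (inl i)) scalerA.
by rewrite (unsplitK (inr i)).
Qed.

Lemma lspan0 : lspan A 0.
Proof. by exists 0%N, (fun=> 0), (fun=> 0); rewrite big_ord0; split=> // -[]. Qed.

Lemma sub_lspan u : A u -> lspan A u.
Proof.
by move=> Au; exists 1%N, (fun=> 1), (fun=> u); rewrite big_ord1 scale1r.
Qed.

Lemma lspan_sum (I : Type) (r : seq I) (c : I -> R) (u : I -> V) :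
  (forall i, lspan A (u i)) -> lspan A (\sum_(i <- r) c i *: u i).
Proof.
move=> uA; elim: r => [|i r IH]; first by rewrite big_nil; exact: lspan0.
by rewrite big_cons; exact: lspan_linear.
Qed.

End Span.

Lemma lip0_sumE (R : realType) (M : metricType R) (o : M) (I : Type)
    (r : seq I) (u : I -> lip0 o) x :
  (\sum_(i <- r) u i) x = \sum_(i <- r) u i x.
Proof.
by elim: r => [|i r IH]; rewrite ?big_nil// !big_cons lip0DE IH.
Qed.

(** * Completeness of the dual of a normed space, and evaluation at a point *)

Section DualComplete.
Context {R : realType} (V : normedModType R).

(** The pointwise limit [l] is linear, and the Cauchy estimate passes to it with the factor [|x|]
    kept. That estimate makes [l] bounded and gives convergence in norm. *)
Lemma topdual_cauchy_cvg (F : set_system (topdual V)) : ProperFilter F ->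
  cauchy F -> cvg F.
Proof.
move=> FF /cauchyP Fc.
have {}Fc e : 0 < e -> exists phi : topdual V,
    F [set psi : topdual V | forall x, `|phi x - psi x| <= e * `|x|].
  move=> e0; have [phi Fphi] := Fc e e0; exists phi.
  apply: filterS Fphi => psi; rewrite -ball_normE /= => pe x.
  by rewrite (le_trans (dual_normP (phi - psi) x))// ler_wpM2r// ltW.
have evc x : cvg ((fun phi : topdual V => phi x) @ F).
  apply/cauchy_cvgP/cauchyP => e e0.
  (* Dividing by [|x| + 1] rather than [|x|] covers [x = 0]. *)
  have x1 : 0 < `|x| + 1 by rewrite ltr_pwDr.
  have [phi Fphi] := Fc _ (divr_gt0 e0 x1); exists (phi x).
  change (F [set psi : topdual V | ball (phi x) e (psi x)]).
  apply: filterS Fphi => psi /(_ x) pe.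
  rewrite -ball_normE /= (le_lt_trans pe)// -mulrA gtr_pMr// mulrC.
  by rewrite ltr_pdivrMr// mul1r ltrDl.
pose l x := lim ((fun phi : topdual V => phi x) @ F).
have lE x : (fun phi : topdual V => phi x) @ F --> l x by exact: evc.
have llin : linear l.
  move=> a x y; apply: cvg_lim; first exact: Rhausdorff.
  rewrite [X in X @ _](_ : _ = fun phi : topdual V => a *: phi x + phi y).
    by apply: cvgD; [apply: cvgZr|]; exact: lE.
  by apply/funext => phi; rewrite linearP.
(* One [phi] is close both to [l] and to [F]-most [psi], so it can serve as the midpoint in an
   [e / 2] argument. *)
have lF e : 0 < e -> exists phi : topdual V,
    (forall x, `|phi x - l x| <= e * `|x|) /\
    F [set psi : topdual V | forall x, `|phi x - psi x| <= e * `|x|].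
  move=> e0; have [phi Fphi] := Fc e e0; exists phi; split=> // x.
  apply: (@closed_cvg _ _ F _ (fun psi : topdual V => `|phi x - psi x|)
    (fun r => r <= e * `|x|)).
  - exact: closed_le.
  - by apply: filterS Fphi => psi /(_ x).
  - by apply: cvg_norm; apply: cvgB; [exact: cvg_cst|exact: lE].
have lcont : continuous l.
  have [phi [phil _]] := lF 1 ltr01.
  pose L : {linear V -> R} := HB.pack l (GRing.isLinear.Build R V R *:%R _ llin).
  apply: (@bounded_linear_continuous _ _ _ L); apply/linear_boundedP.
  near=> C => x /=; rewrite -[l x](subKr (phi x)) (le_trans (ler_normB _ _))//.
  rewrite (@le_trans _ _ ((`|phi| + 1) * `|x|))//.
    by rewrite mulrDl lerD ?dual_normP.
  by rewrite ler_wpM2r.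
have lP : l \in @dual_pred R V by apply/asboolP.
apply/cvg_ex; exists (TopDual lP); apply/cvgrPdist_le => e e0.
have [phi [phil phiF]] := lF (e / 2) (divr_gt0 e0 (ltr0n _ 2)).
apply: filterS phiF => psi phipsi; apply: dual_norm_le => [|x]; first exact: ltW.
have -> : (TopDual lP - psi) x = (phi x - psi x) - (phi x - l x).
  by rewrite -[LHS]/(l x - psi x); lra.
rewrite (le_trans (ler_normB _ _))// [e]splitr mulrDl lerD//.
Unshelve. all: end_near. Qed.

HB.instance Definition _ :=
  Uniform_isComplete.Build (topdual V) topdual_cauchy_cvg.

Lemma cvg_dual_eval (T : Type) (F : set_system T) (FF : Filter F)
    (u : T -> topdual V) (phi : topdual V) x :
  u @ F --> phi -> (fun t => u t x) @ F --> phi x.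
Proof.
move=> uphi; apply/cvgrPdist_lt => e e0.
have x1 : 0 < `|x| + 1 by rewrite ltr_pwDr.
move/cvgrPdist_lt : uphi => /(_ _ (divr_gt0 e0 x1)); apply: filterS => t ut.
rewrite (le_lt_trans (dual_normP (phi - u t) x))//.
rewrite (@le_lt_trans _ _ (e / (`|x| + 1) * `|x|))//.
  by rewrite ler_wpM2r// ltW.
by rewrite -mulrA gtr_pMr// mulrC ltr_pdivrMr// mul1r ltrDl.
Qed.

Lemma dualBE (phi psi : topdual V) x : (phi - psi) x = phi x - psi x.
Proof. by []. Qed.

Lemma dual_sumE (I : Type) (r : seq I) (u : I -> topdual V) x :
  (\sum_(i <- r) u i) x = \sum_(i <- r) u i x.
Proof.
by elim: r => [|i r IH]; rewrite ?big_nil// !big_cons dualDE IH.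
Qed.

End DualComplete.

(** * Finite partial sums in l^1 and unconditional summation *)

Section Ell1Sums.
Context {R : realType} (I : choiceType).
Implicit Types (c : ell1 R I) (A B : {fset I}).

(** Passes from finite subsets, over which [esum] is taken, to the [{fset I}] that index the net of
    [family_sum]. *)
Lemma esum_fsets (a : I -> \bar R) :
  (\esum_(i in [set: I]) a i =
   ereal_sup [set \sum_(i <- A) a i | A in [set: {fset I}]])%E.
Proof.
rewrite /esum; congr ereal_sup; apply/seteqP; split=> _ [A Ap <-].
  by exists (fset_set A) => //; rewrite fsbig_finite//; case: Ap.
exists [set` A]; first by split.
by rewrite fsbig_finite// set_fsetK.
Qed.

Lemma summable_bound (a : I -> R) C :
  (forall A, \sum_(i <- A) `|a i| <= C) -> summable [set: I] (EFin \o a).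
Proof.
move=> aC; rewrite /summable esum_fsets (@le_lt_trans _ _ C%:E)// ?ltry//.
by apply: ge_ereal_sup => _ [A _ <-]; rewrite /= sumEFin lee_fin.
Qed.

Lemma ell1_norm_le c C : (forall A, \sum_(i <- A) `|c i| <= C) -> `|c| <= C.
Proof.
move=> aC; rewrite ell1_norm_def -lee_fin ell1_normE esum_fsets.
by apply: ge_ereal_sup => _ [A _ <-]; rewrite /= sumEFin lee_fin.
Qed.

Lemma ell1_sum_le c A : \sum_(i <- A) `|c i| <= `|c|.
Proof.
rewrite ell1_norm_def -lee_fin ell1_normE esum_fsets.
by apply: ereal_sup_ubound; exists A => //; rewrite sumEFin.
Qed.

Lemma ell1_sum_gt c e : 0 < e -> exists A, `|c| - e < \sum_(i <- A) `|c i|.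
Proof.
move=> e0; apply: contrapT => /forallNP cA.
have : `|c| <= `|c| - e.
  by apply: ell1_norm_le => A; rewrite leNgt; apply/negP/cA.
by rewrite leNgt ltrBlDr ltrDl e0.
Qed.

(** The net is Cauchy: if the sum of [|c i|] over [A] exceeds [|c| - e], then over any finite set
    disjoint from [A] it is below [e], and it dominates the sum of the [v i]. *)
Lemma family_sum_cvg (V : completeNormedModType R) (v : I -> V) c :
  (forall i, `|v i| <= `|c i|) ->
  (fun B => \sum_(i <- B) v i) @ fset_filter I --> family_sum v.
Proof.
move=> vc; apply/cauchy_cvgP/cauchyP => e e0.
have [A cA] := ell1_sum_gt c e0; exists (\sum_(i <- A) v i).
exists A => //= B AB /=; rewrite -ball_normE /= distrC.
have split (W : zmodType) (w : I -> W) :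
    \sum_(i <- B) w i = \sum_(i <- A) w i + \sum_(i <- (B `\` A)%fset) w i.
  rewrite (big_fsetID _ (mem A)) /=; congr (_ + _).
    apply: eq_fbigl => i; rewrite !inE andbC.
    by case: (boolP (i \in A)) => //= /(fsubsetP AB).
  by apply: eq_fbigl => i; rewrite !inE andbC.
rewrite split addrC addKr (le_lt_trans (ler_norm_sum _ _ _))//.
rewrite (@le_lt_trans _ _ (\sum_(i <- (B `\` A)%fset) `|c i|)) ?ler_sum//.
by have := ell1_sum_le c B; rewrite split; lra.
Qed.

End Ell1Sums.

(** * Relative position of gaps and points of [K] *)

Section GapGeometry.
Context {R : realType} (K : set R) (hK : [/\ K `<=` `[0, +oo[, closed K & K 0]).
Implicit Types (I J : gaps K) (k : K) (s t x y : R).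

Local Notation a_ I := (val (gap_left hK I)).
Local Notation b_ I := (val (gap_right hK I)).

Lemma val_ge0 k : 0 <= val k.
Proof.
have [Kge0 _ _] := hK.
by have := Kge0 _ (set_mem (valP k)); rewrite /= in_itv/= andbT.
Qed.

Lemma gap_lt I : a_ I < b_ I.
Proof. by have [] := gapP hK I. Qed.

Lemma gapE I : val I = `]a_ I, b_ I[%classic.
Proof. by have [] := gapP hK I. Qed.

Lemma gap_avoid I k : val k <= a_ I \/ b_ I <= val k.
Proof.
have [?|ak] := leP (val k) (a_ I); first by left.
have [?|kb] := leP (b_ I) (val k); first by right.
have : val I (val k) by rewrite gapE /= in_itv/= ak kb.
have [_ [x _ ->]] := set_mem (valP I).
by move=> /connected_component_sub[_ /(_ (set_mem (valP k)))].
Qed.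

Lemma gap_eq I J t : a_ I < t < b_ I -> a_ J < t < b_ J -> I = J.
Proof.
move=> tI tJ; apply: val_inj.
have : val I t by rewrite gapE /= in_itv.
have : val J t by rewrite gapE /= in_itv.
have [_ [x _ ->]] := set_mem (valP I).
have [_ [y _ ->]] := set_mem (valP J).
by move=> /same_connected_component -> /same_connected_component ->.
Qed.

(** Endpoints of gaps lie in [K], hence outside every gap. If neither alternative holds, the left
    endpoints coincide, so the two gaps share a point and are the same component. *)
Lemma gap_sep I J : I != J -> b_ I <= a_ J \/ b_ J <= a_ I.
Proof.
move=> IJ; have ltI := gap_lt I; have ltJ := gap_lt J.
have [IaJ|] := gap_avoid I (gap_left hK J); last by left.
have [JaI|] := gap_avoid J (gap_left hK I); last by right.
have ab : a_ I = a_ J by apply/eqP; rewrite eq_le JaI IaJ.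
case/eqP: IJ; pose m := Num.min (b_ I) (b_ J).
have am : a_ I < m by rewrite lt_min ltI ab.
have [mI mJ] : m <= b_ I /\ m <= b_ J by rewrite !ge_min !lexx orbT.
by apply: (@gap_eq _ _ ((a_ I + m) / 2)); apply/andP; split; lra.
Qed.

(** The component of [t] cannot reach [val k], a point of [K], so it is bounded and therefore a
    gap. *)
Lemma gap_cover k t : 0 <= t <= val k -> ~ K t ->
  exists I, a_ I < t < b_ I.
Proof.
move=> /andP[t0 tk] nKt.
have [Kge0 clK K0] := hK.
have Kk : K (val k) := set_mem (valP k).
pose C := connected_component (hull K `\` K) t.
have Ht : (hull K `\` K) t.
  split=> //; apply/(hullP hK); split=> //.
  apply: (@le_trans _ _ (val k)%:E); first by rewrite lee_fin.
  by apply: ereal_sup_ubound; exists (val k).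
have Ct : C t by exact: connected_component_refl.
have Citv : is_interval C.
  by apply/connected_intervalP; exact: component_connected.
have Cnk : ~ C (val k) by move=> /connected_component_sub[_ /(_ Kk)].
have bC : bounded_set C.
  exists (val k); split=> [|M kM y Cy]; first exact: num_real.
  have y0 : 0 <= y.
    by have [/(hullP hK)[]] := connected_component_sub Cy.
  rewrite /= ger0_norm// (le_trans _ (ltW kM))// leNgt; apply/negP => ky.
  by apply: Cnk; apply: (Citv t y) => //; rewrite tk ltW.
have gC : C \in gaps K by apply/mem_set; split=> //; exists t.
pose I : gaps K := exist _ C gC.
exists I; have : val I t by exact: Ct.
by rewrite gapE /= in_itv.
Qed.

End GapGeometry.

(** * Countability: constancy across gaps and existence of a gap *)

Lemma countable_itv (R : realType) (x y : R) : x < y ->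
  ~ countable `[x, y]%classic.
Proof.
move=> xy /countable_lebesgue_measure0.
rewrite lebesgue_measure_itv/= lte_fin xy -EFinB => -[] /eqP.
by rewrite subr_eq0 gt_eqF.
Qed.

Section GapConstant.
Context {R : realType} (K : set R) (hK : [/\ K `<=` `[0, +oo[, closed K & K 0]).
Context (Kcountable : countable K).

Local Notation a_ I := (val (gap_left hK I)).
Local Notation b_ I := (val (gap_right hK I)).

Lemma gap_constant (g : K -> R) (L : R) :
  (forall x y : K, `|g x - g y| <= L * `|val x - val y|) ->
  (forall I, g (gap_left hK I) = g (gap_right hK I)) ->
  forall k, g k = g (base hK).
Proof.
move=> gL ggap k.
(* For t in [0, val k], pq t is (t, t) if t is in K, and the pair of endpoints
   of the gap containing t otherwise; F below is the extension of g that is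
   constant on the gaps, precomposed with the retraction c onto [0, val k]. *)
have /choice[pq pqP] : forall t : R, exists pq : K * K, 0 <= t <= val k ->
    (val pq.1 = t /\ val pq.2 = t) \/
    exists2 I, a_ I < t < b_ I & pq = (gap_left hK I, gap_right hK I).
  move=> t; have [t0k|] := boolP (0 <= t <= val k); last first.
    by exists (k, k).
  have [Kt|nKt] := pselect (K t).
    by exists (exist _ t (mem_set Kt), exist _ t (mem_set Kt)) => _; left.
  have [I tI] := gap_cover hK t0k nKt.
  by exists (gap_left hK I, gap_right hK I) => _; right; exists I.
pose c (t : R) := Num.max 0 (Num.min t (val k)).
have k0 := val_ge0 hK k.
have cP s t : s <= t -> [/\ 0 <= c s, c s <= c t, c t <= val k & c t - c s <= t - s].
  rewrite /c => st; split.
  - by rewrite le_max lexx.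
  - by rewrite le_max2 ?le_min2.
  - by rewrite ge_max k0 ge_min lexx orbT.
  - case: (leP t (val k)) => tk; case: (leP s (val k)) => sk;
      rewrite ?(max_r k0)//;
      have [?|?] := leP 0 t; have [?|?] := leP 0 s; lra.
pose F t := g (pq (c t)).1.
(* The sign of [L] is not assumed; [|L|] makes the bound monotone in the distance. *)
have Fmono s t : s <= t -> `|F s - F t| <= `|L| * (t - s).
  move=> st; have [c0 cst ctk cts] := cP _ _ st.
  have Fle (x y : K) : val x <= val y -> c s <= val x -> val y <= c t ->
      `|g x - g y| <= `|L| * (t - s).
    move=> xy sx yt; rewrite (le_trans (gL _ _))// distrC ger0_norm ?subr_ge0//.
    rewrite (@le_trans _ _ (`|L| * (val y - val x)))//.
      by rewrite ler_wpM2r ?subr_ge0// ler_norm.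
    by rewrite ler_wpM2l//; lra.
  have cs0k : 0 <= c s <= val k by rewrite c0 (le_trans cst).
  have ct0k : 0 <= c t <= val k by rewrite ctk (le_trans c0).
  rewrite /F.
  (* If [c s] lies in a gap, [ggap] replaces its left end by its right end, so that both points
     given to [Fle] lie between [c s] and [c t]. If both parameters lie in one gap, the values of
     [F] agree. *)
  case: (pqP _ cs0k) => [[ps qs]|[I sI ->]];
    case: (pqP _ ct0k) => [[pt qt]|[J tJ ->]] /=.
  - by apply: Fle; rewrite ?ps ?pt.
  - have [sa|bs] := gap_avoid hK J (pq (c s)).1.
      by apply: Fle; rewrite ?ps//; move: sa tJ; rewrite ps; lra.
    by move: bs; rewrite ps; lra.
  - have [ta|bt] := gap_avoid hK I (pq (c t)).1.
      by move: ta; rewrite pt; lra.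
    by rewrite ggap; apply: Fle; rewrite ?pt//; move: bt sI; rewrite ?pt; lra.
  - have [->|IJ] := eqVneq I J.
      by rewrite subrr normr0; apply: mulr_ge0; [exact: normr_ge0|lra].
    rewrite ggap; have [?|?] := gap_sep hK IJ; last by lra.
    by apply: Fle; lra.
have Fc : continuous F.
  move=> x; apply/cvgrPdist_lt => e e0; near=> y.
  have Fxy : `|F x - F y| <= `|L| * `|x - y|.
    have [xy|/ltW yx] := leP x y.
      by have := Fmono _ _ xy; rewrite -[t in _ * t]ger0_norm ?subr_ge0// (distrC y).
    have := Fmono _ _ yx; rewrite distrC.
    by rewrite -[t in _ * t]ger0_norm ?subr_ge0// (distrC x).
  rewrite (le_lt_trans Fxy)// (@le_lt_trans _ _ ((`|L| + 1) * `|x - y|))//.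
    by rewrite ler_wpM2r// lerDl.
  rewrite mulrC -ltr_pdivlMr ?ltr_pwDr//.
  near: y; apply: cvgr_dist_lt; rewrite ?divr_gt0 ?ltr_pwDr//.
have FE (x : K) : val x <= val k -> F (val x) = g x.
  move=> xk; have x0 := val_ge0 hK x.
  have cx : c (val x) = val x by rewrite /c min_l// max_r.
  rewrite /F; case: (pqP (c (val x))); rewrite cx ?x0//.
    by move=> [px _]; congr g; exact: val_inj.
  by move=> [I xI _]; case: (gap_avoid hK I x) => ?; lra.
apply/eqP/negPn/negP => gk.
pose m := Num.min (g (base hK)) (g k); pose M := Num.max (g (base hK)) (g k).
have mM : m < M.
  by rewrite /m /M; case: (ltgtP (g k) (g (base hK))) gk => //.
(* By the intermediate value theorem, every value between [m] and [M] is taken by [F], hence by [g],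
   whose range is countable. *)
apply: (countable_itv mM); apply: (@sub_countable _ _ _ (range g)); last first.
  apply: sub_countable (card_image_le _ _) _.
  by rewrite (eq_countable (card_setT _)).
apply: subset_card_le => v /=; rewrite in_itv/= => vmM.
have := @IVT R F 0 (val k) v k0 (continuous_subspaceT Fc).
rewrite (FE k)// -[0]/(val (base hK)) FE//= => /(_ vmM)[t _ <-].
by exists (pq (c t)).1.
Unshelve. all: end_near. Qed.

(** Without gaps, [gap_cover] would put all of [[0, x]] in [K] for any [x > 0] in [K], against
    countability. *)
Lemma gaps_nonempty : infinite_set K -> [set: gaps K] !=set0.
Proof.
move=> Kinf; apply: contrapT => nI; apply: Kinf.
apply: (@sub_finite_set _ _ [set 0]); last exact: finite_set1.
move=> x Kx /=; pose k : K := exist _ x (mem_set Kx).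
apply: contrapT => /eqP x0.
have {}x0 : 0 < x by rewrite lt_neqAle eq_sym x0 (val_ge0 hK k).
apply: (countable_itv x0); apply: sub_countable Kcountable.
apply: subset_card_le => t /=; rewrite in_itv/= => tx.
apply: contrapT => nKt; apply: nI.
by have [I _] := @gap_cover _ _ hK k t tx nKt; exists I.
Qed.

End GapConstant.

(** * Step functions of the gaps and the coordinate map P *)

Section GapSteps.
Context {R : realType} (K : set R) (hK : [/\ K `<=` `[0, +oo[, closed K & K 0]).
Implicit Types (I J : gaps K) (x y : K) (B : {fset gaps K}).
Implicit Types (f : lip0 (base hK)) (phi : topdual (lip0 (base hK))).

Local Notation a_ I := (val (gap_left hK I)).
Local Notation b_ I := (val (gap_right hK I)).
Local Notation mu_ := (gap_molecule hK).
Local Notation delta := (delta (base hK)).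

(** Induction on [r] with [s] and [t] free: a gap [J] inside [[s, t]] leaves [[s, a_J]] and
    [[b_J, t]], and by [gap_sep] any other gap inside [[s, t]] lies in one of these. *)
Lemma sum_gap_length (r : seq (gaps K)) (s t : R) : uniq r -> s <= t ->
  \sum_(I <- r | (s <= a_ I) && (b_ I <= t)) (b_ I - a_ I) <= t - s.
Proof.
elim: r s t => [|J r IH] s t /=; first by rewrite big_nil subr_ge0.
move=> /andP[Jr ur] st; rewrite big_cons.
case: ifPn => [/andP[sJ Jt]|_]; last exact: IH.
apply: (@le_trans _ _ ((b_ J - a_ J) + ((a_ J - s) + (t - b_ J)))); last by lra.
rewrite lerD2l; apply: le_trans (lerD (IH s (a_ J) ur sJ) (IH (b_ J) t ur Jt)).
rewrite !(big_mkcond (fun I => _ && _)) -big_split /= !big_seq.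
apply: ler_sum => I Ir; have ltI := gap_lt hK I.
have ltJ := gap_lt hK J; have IJ : I != J by apply: contraNneq Jr => <-.
move: (gap_sep hK IJ) ltI ltJ sJ Jt => /=.
move: (inf (sval I)) (sup (sval I)) (inf (sval J)) (sup (sval J)) => a b a' b'.
by case=> ? ? ? ? ?; case: (leP s a) => ?; case: (leP b t) => ?;
  case: (leP b a') => ?; case: (leP b' a) => ? /=; lra.
Qed.

Definition step_fun I (x : K) : R := if b_ I <= val x then b_ I - a_ I else 0.

Lemma step_funB I x y : val x <= val y -> step_fun I y - step_fun I x =
  if (val x <= a_ I) && (b_ I <= val y) then b_ I - a_ I else 0.
Proof.
move=> xy; have ltI := gap_lt hK I; rewrite /step_fun.
move: (gap_avoid hK I x) (gap_avoid hK I y) ltI xy => /=.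
move: (inf (sval I)) (sup (sval I)) (sval x) (sval y) => a b s t.
by do 2![case=> ?] => ? ?; case: (leP b s) => ?; case: (leP b t) => ?;
  case: (leP s a) => ? /=; lra.
Qed.

(** Between two points of [K], a step changes only if its gap lies between them, and then by the
    length of that gap; [sum_gap_length] bounds the total. *)
Lemma sum_step_fun_le (B : {fset gaps K}) (e : gaps K -> R) x y :
  (forall I, `|e I| <= 1) ->
  `|\sum_(I <- B) e I * (step_fun I x - step_fun I y)| <= mdist x y.
Proof.
move=> e1; rewrite -[mdist x y]/(`|val x - val y|).
wlog xy : x y / val y <= val x => [H|].
  have [|/ltW yx] := leP (val y) (val x); first exact: H.
  rewrite distrC -[leLHS]normrN -sumrN; under eq_bigr do rewrite -mulrN opprB.
  exact: H.
rewrite (le_trans (ler_norm_sum _ _ _))//.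
rewrite [leRHS]ger0_norm ?subr_ge0//.
apply: le_trans (sum_gap_length (fset_uniq B) xy).
rewrite [leRHS]big_mkcond /=; apply: ler_sum => I _.
rewrite step_funB//; have ltI := gap_lt hK I.
case: ifP => _; last by rewrite mulr0 normr0.
have d0 : 0 <= b_ I - a_ I by rewrite subr_ge0 ltW.
by rewrite normrM (ger0_norm d0); apply: ler_piMl.
Qed.

Lemma step_lip0P I : step_fun I \in lip0_pred (base hK).
Proof.
apply/asboolP; split.
  rewrite /step_fun leNgt -[val (base hK)]/(0 : R).
  by rewrite (le_lt_trans (val_ge0 hK (gap_left hK I)) (gap_lt hK I)).
exists 1 => x y; have := @sum_step_fun_le [fset I]%fset (fun=> 1) x y.
rewrite big_seq_fset1 !mul1r; apply=> _; by rewrite normr1.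
Qed.

Definition gap_step I : lip0 (base hK) := Lip0 (step_lip0P I).

Lemma gap_step_sum_norm B (e : gaps K -> R) : (forall I, `|e I| <= 1) ->
  `|\sum_(I <- B) e I *: gap_step I| <= 1.
Proof.
move=> e1; apply: lip_norm_le => // x y; rewrite mul1r !lip0_sumE -sumrB.
under eq_bigr do rewrite !lip0ZE -mulrBr.
exact: sum_step_fun_le.
Qed.

Lemma gap_moleculeE I f : mu_ I f = gap_slope I f.
Proof. by rewrite /gap_slope mulrC. Qed.

(** Biorthogonality of molecules and steps, which makes [coords] a left inverse of the synthesis
    map. *)
Lemma gap_slope_step I J : gap_slope I (gap_step J) = (I == J)%:R.
Proof.
have ltI := gap_lt hK I; have ltJ := gap_lt hK J.
rewrite /gap_slope [X in X / _](step_funB _ (ltW ltI)).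
have [<-|/(gap_sep hK) IJ] := eqVneq I J.
  by rewrite !lexx divff// subr_eq0 gt_eqF.
by case: ifP => [/andP[? ?]|_]; [case: IJ => ?; lra|rewrite mul0r].
Qed.

Lemma gap_slope_le I f : `|gap_slope I f| <= `|f|.
Proof.
have ltI := gap_lt hK I.
rewrite normrM normfV ler_pdivrMr ?normr_gt0 ?subr_eq0 ?gt_eqF//.
exact: lip_normP.
Qed.

Lemma gap_molecule_norm I : `|mu_ I| <= 1.
Proof.
by apply: dual_norm_le => // f; rewrite gap_moleculeE mul1r gap_slope_le.
Qed.

Lemma gap_molecule_span I : lspan (range delta) (mu_ I).
Proof.
rewrite -[mu_ I]addr0; apply: lspan_linear; last exact: lspan0.
rewrite -scaleN1r addrC; apply: lspan_linear; apply: sub_lspan; eexists => //.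
Qed.

Lemma deltaB_norm x y : `|delta x - delta y| <= mdist x y.
Proof.
apply: dual_norm_le => [|f]; first exact: mdist_ge0.
by rewrite mulrC; exact: lip_normP.
Qed.

(** Duality: the left side is [phi] evaluated at the sum of the steps weighted by the signs of the
    coordinates, an element of norm at most 1. *)
Lemma sum_coords_le phi B : \sum_(I <- B) `|phi (gap_step I)| <= `|phi|.
Proof.
have -> : \sum_(I <- B) `|phi (gap_step I)| =
    phi (\sum_(I <- B) Num.sg (phi (gap_step I)) *: gap_step I).
  by rewrite linear_sum; apply: eq_bigr => I _; rewrite linearZ /= normrEsg.
rewrite (le_trans (ler_norm _))// (le_trans (dual_normP _ _))//.
rewrite ler_piMr ?dual_norm_ge0//; apply: gap_step_sum_norm => I.
by rewrite normr_sg; case: (_ != 0).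
Qed.

Fact coords_ell1 phi : (fun I => phi (gap_step I)) \in @ell1_pred R (gaps K).
Proof. by apply/asboolP; apply: summable_bound (sum_coords_le phi). Qed.

(** The map P, defined on the whole dual of Lip_0(K) and not only on the free space. *)
Definition coords phi : ell1 R (gaps K) := Ell1 (coords_ell1 phi).

Lemma coords_linear : linear coords.
Proof. by move=> a phi psi; apply/val_inj/funext. Qed.

Lemma coords_norm phi : `|coords phi| <= `|phi|.
Proof. by apply: ell1_norm_le => B; exact: sum_coords_le. Qed.

(** * The synthesis operator U is an isometry with left inverse P *)

Local Notation U := (gap_synthesis hK).
Implicit Types (c : ell1 R (gaps K)).

(** Molecules have norm at most 1, so [c] dominates the terms and the [lim] in [family_sum] is a
    genuine limit. *)
Lemma gap_synthesis_cvg c :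
  (fun B => \sum_(I <- B) c I *: mu_ I) @ fset_filter (gaps K) --> U c.
Proof.
apply: (@family_sum_cvg _ _ (topdual (lip0 (base hK))) _ c) => I.
by rewrite normrZ ler_piMr ?gap_molecule_norm.
Qed.

Lemma gap_synthesis_eval_cvg c f :
  (fun B => \sum_(I <- B) c I * gap_slope I f) @ fset_filter (gaps K) --> U c f.
Proof.
rewrite [X in X @ _](_ : _ = fun B => (\sum_(I <- B) c I *: mu_ I) f).
  by apply: cvg_dual_eval; exact: gap_synthesis_cvg.
apply/funext => B; rewrite dual_sumE; apply: eq_bigr => I _.
by rewrite dualZE gap_moleculeE.
Qed.

Lemma gap_synthesis_eval c f (l : R) :
  (fun B => \sum_(I <- B) c I * gap_slope I f) @ fset_filter (gaps K) --> l ->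
  U c f = l.
Proof.
move=> cl; rewrite -(cvg_lim (@Rhausdorff R) (@gap_synthesis_eval_cvg c f)).
exact: cvg_lim cl.
Qed.

Lemma gap_synthesis_linear : linear U.
Proof.
move=> a c d; apply/val_inj/funext => f; apply: gap_synthesis_eval.
rewrite [X in X @ _](_ : _ = fun B => a *: (\sum_(I <- B) c I * gap_slope I f) +
    \sum_(I <- B) d I * gap_slope I f).
  by apply: cvgD; [apply: cvgZr|]; exact: gap_synthesis_eval_cvg.
apply/funext => B; rewrite scaler_sumr -big_split; apply: eq_bigr => I _ /=.
by rewrite mulrDl -scalerAl.
Qed.

(** The bound sees [f] only through its gap slopes; this is what later yields the formula for the
    Lipschitz norm. *)
Lemma gap_synthesis_eval_le c f C : 0 <= C -> (forall I, `|gap_slope I f| <= C) ->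
  `|U c f| <= C * `|c|.
Proof.
move=> C0 fC; apply: (@closed_cvg _ _ (fset_filter (gaps K)) _
  (fun B => `|\sum_(I <- B) c I * gap_slope I f|) (fun r => r <= C * `|c|)).
- exact: closed_le.
- apply: nearW => B; rewrite (le_trans (ler_norm_sum _ _ _))//.
  apply: le_trans (ler_wpM2l C0 (ell1_sum_le c B)).
  rewrite mulr_sumr; apply: ler_sum => I _.
  by rewrite normrM mulrC ler_wpM2r.
- by apply: cvg_norm; exact: gap_synthesis_eval_cvg.
Qed.

Lemma gap_synthesis_norm_le c : `|U c| <= `|c|.
Proof.
apply: dual_norm_le => // f; rewrite mulrC.
by apply: gap_synthesis_eval_le => // I; exact: gap_slope_le.
Qed.

(** The partial sums are constant as soon as the finite set contains [I]. *)
Lemma gap_synthesis_eval1 c f I :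
  (forall J, J != I -> c J * gap_slope J f = 0) -> U c f = c I * gap_slope I f.
Proof.
move=> cI; apply: gap_synthesis_eval; apply: cvg_near_cst.
exists [fset I]%fset => // B /= /fsubsetP IB.
rewrite (big_fsetD1 I) /=; last by apply: IB; rewrite inE.
by rewrite big_seq big1 ?addr0// => J; rewrite !inE => /andP[/cI].
Qed.

Lemma gap_synthesisK : cancel U coords.
Proof.
move=> c; apply/val_inj/funext => I /=; rewrite (@gap_synthesis_eval1 _ _ I).
  by rewrite gap_slope_step eqxx mulr1.
by move=> J /negbTE JI; rewrite gap_slope_step JI mulr0.
Qed.

Lemma gap_synthesis_norm c : `|U c| = `|c|.
Proof.
apply/eqP; rewrite eq_le gap_synthesis_norm_le/=.
(* The lower bound: [c] is the image of [U c] under the contraction [coords]. *)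
by rewrite -{1}(gap_synthesisK c) coords_norm.
Qed.

(** By biorthogonality the coordinates of [mu_ I] form the unit vector at [I]. *)
Lemma gap_synthesis_coords_molecule I : U (coords (mu_ I)) = mu_ I.
Proof.
have cE J : coords (mu_ I) J = (I == J)%:R.
  by rewrite -gap_slope_step -gap_moleculeE.
apply/val_inj/funext => f; rewrite -[LHS]/(U (coords (mu_ I)) f).
rewrite (@gap_synthesis_eval1 _ _ I) => [|J /negbTE JI].
  by rewrite cE eqxx mul1r -gap_moleculeE.
by rewrite cE eq_sym JI mul0r.
Qed.

(** * The contraction U P and its fixed points *)

Definition gap_proj phi := U (coords phi).

Lemma gap_proj_linear : linear gap_proj.
Proof.
by move=> a phi psi; rewrite /gap_proj coords_linear gap_synthesis_linear.
Qed.

HB.instance Definition _ := GRing.isLinear.Build R (topdual (lip0 (base hK)))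
  (topdual (lip0 (base hK))) *:%R gap_proj gap_proj_linear.

Lemma gap_projB phi psi : gap_proj (phi - psi) = gap_proj phi - gap_proj psi.
Proof. exact: linearB. Qed.

Lemma gap_projZ (l : R) phi : gap_proj (l *: phi) = l *: gap_proj phi.
Proof. exact: linearZ. Qed.

Lemma gap_proj_norm phi : `|gap_proj phi| <= `|phi|.
Proof. by rewrite /gap_proj gap_synthesis_norm coords_norm. Qed.

Context (Kcountable : countable K).

Lemma gap_proj_delta x : gap_proj (delta x) = delta x.
Proof.
apply/val_inj/funext => f; rewrite -[LHS]/(gap_proj (delta x) f) -[RHS]/(f x).
pose g y := gap_proj (delta y) f - f y.
have gB y z : g y - g z = gap_proj (delta y - delta z) f - (f y - f z).
  by rewrite gap_projB dualBE /g; lra.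
apply/eqP; rewrite -subr_eq0 -/(g x).
have -> : g x = g (base hK).
  (* One [|f|] bounds the variation of the first term of [g], since U P is contractive and [delta]
     is 1-Lipschitz; the other bounds that of [f]. *)
  apply: (gap_constant Kcountable (L := `|f| + `|f|)) => [y z|I].
    rewrite gB (le_trans (ler_normB _ _))// mulrDl lerD ?lip_normP//.
    rewrite (le_trans (dual_normP _ _))// mulrC ler_wpM2l//.
    exact: le_trans (gap_proj_norm _) (deltaB_norm y z).
  apply/eqP; rewrite eq_sym -subr_eq0 gB.
  have d0 : b_ I - a_ I != 0 by rewrite subr_eq0 gt_eqF// gap_lt.
  have -> : delta (gap_right hK I) - delta (gap_left hK I) = (b_ I - a_ I) *: mu_ I.
    by rewrite /gap_molecule scalerA divff// scale1r.
  rewrite gap_projZ dualZE [gap_proj _]gap_synthesis_coords_molecule.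
  by rewrite gap_moleculeE /gap_slope mulrC divfK// subrr.
(* The constant is 0, because [delta] vanishes at the base point. *)
have delta0 : delta (base hK) = 0.
  by apply/val_inj/funext => h; exact: lip0_base.
by rewrite /g delta0 linear0 lip0_base subr0.
Qed.

(** U P fixes the span of the [delta x] by linearity; being contractive, it also fixes the
    closure. *)
Lemma gap_proj_lipfree phi : lipfree (base hK) phi -> gap_proj phi = phi.
Proof.
move=> phiF; apply/eqP; rewrite -subr_eq0 -normr_le0; apply/ler_addgt0Pl => e e0.
have e2 : 0 < e / 2 by rewrite divr_gt0.
have [psi [[n [a [u [udelta psiE]]]]]] := phiF _ (nbhsx_ballx phi _ e2).
rewrite -ball_normE /= => phipsi.
have psifix : gap_proj psi = psi.
  rewrite psiE linear_sum; apply: eq_bigr => i _; rewrite linearZ /=.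
  by have [x _ <-] := udelta i; rewrite gap_proj_delta.
have -> : gap_proj phi - phi = gap_proj (phi - psi) - (phi - psi).
  by rewrite gap_projB psifix opprB addrA subrK.
rewrite addr0 [e]splitr (le_trans (ler_normB _ _))// lerD//; last exact: ltW.
exact: le_trans (gap_proj_norm _) (ltW phipsi).
Qed.

(** Since U P fixes [delta x - delta y], the increment of [f] is a sum of gap slopes whose
    coefficients have l^1 norm at most the distance from [x] to [y]. *)
Lemma lip_norm_gap_le f C : 0 <= C -> (forall I, `|gap_slope I f| <= C) ->
  `|f| <= C.
Proof.
move=> C0 fC; apply: lip_norm_le => // x y.
have -> : f x - f y = U (coords (delta x - delta y)) f.
  by rewrite -/(gap_proj _) gap_projB !gap_proj_delta.
rewrite (le_trans (gap_synthesis_eval_le _ C0 fC))// ler_wpM2l//.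
exact: le_trans (coords_norm _) (deltaB_norm x y).
Qed.

End GapSteps.

Theorem lemma5p1 (R : realType) (K : set R)
    (hK : [/\ K `<=` `[0, +oo[, closed K & K 0])
    (Kinfinite : infinite_set K) (Kcountable : countable K) :
  (forall I : gaps K, lipfree (base hK) (gap_molecule hK I)) /\
  [/\ forall c : ell1 R (gaps K),
        (fun B : {fset gaps K} => \sum_(I <- B) c I *: gap_molecule hK I)
          @ fset_filter (gaps K) --> gap_synthesis hK c,
      linear (gap_synthesis hK),
      forall c : ell1 R (gaps K), `|gap_synthesis hK c| = `|c| &
      set_bij [set: ell1 R (gaps K)] (lipfree (base hK)) (gap_synthesis hK)] /\
  (forall f : lip0 (base hK),
    (`|f|)%:E =
      ereal_sup [set (`|gap_slope I f|)%:E | I in [set: gaps K]]).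
Proof.
(* Finite partial sums lie in the span of the [delta x], and [lipfree] is closed. *)
have Ufree c : lipfree (base hK) (gap_synthesis hK c).
  apply: (@closed_cvg _ _ (fset_filter (gaps K)) _ _ (lipfree (base hK)) _ _ _
    (@gap_synthesis_cvg _ _ hK c)); first exact: closed_closure.
  apply: nearW => B; apply: subset_closure; apply: lspan_sum => I.
  exact: gap_molecule_span.
split; first by move=> I; apply: subset_closure; exact: gap_molecule_span.
split.
  split.
  - exact: gap_synthesis_cvg.
  - exact: gap_synthesis_linear.
  - exact: gap_synthesis_norm.
  - split.
    + by move=> c _; exact: Ufree.
    + by apply: in2W; exact: can_inj (@gap_synthesisK _ _ hK).
    + by move=> phi /(gap_proj_lipfree Kcountable) <-; exists (coords phi).
move=> f; apply/eqP; rewrite eq_le; apply/andP; split; last first.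
  by apply: ge_ereal_sup => _ [I _ <-]; rewrite lee_fin gap_slope_le.
(* A gap keeps the supremum away from [-oo], its value on the empty family, and makes a finite
   supremum nonnegative. *)
have [I0 _] := gaps_nonempty hK Kcountable Kinfinite.
have sup_ge I : ((`|gap_slope I f|)%:E <=
    ereal_sup [set (`|gap_slope I f|)%:E | I in [set: gaps K]])%E.
  by apply: ereal_sup_ubound; exists I.
case: (ereal_sup _) sup_ge => [C||] sup_ge; last by have := sup_ge I0.
  rewrite lee_fin; apply: (lip_norm_gap_le Kcountable) => [|I].
    by apply: le_trans (normr_ge0 (gap_slope I0 f)) _; rewrite -lee_fin.
  by rewrite -lee_fin.
by rewrite leey.
Qed.
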